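(* Let $\mathbb{F}$ be a finite field, let $\delta,k,n$ be positive integers with $k<n$, and let $\Sigma=(A,B,C,D)$ be a linear system with $A\in\mathbb{F}^{\delta\times\delta}$, $B\in\mathbb{F}^{\delta\times k}$, $C\in\mathbb{F}^{(n-k)\times\delta}$, $D\in\mathbb{F}^{(n-k)\times k}$. The output observability of $\Sigma$ is invariant under each of the following group actions, that is, $\Sigma$ is output observable if and only if the transformed system is output observable: (i) $\Sigma\mapsto\Sigma_2=(A,\,BQ,\,C,\,DQ)$, for any invertible matrix $Q\in\mathbb{F}^{k\times k}$; (ii) $\Sigma\mapsto\Sigma_3=(A,\,B,\,H^{-1}C,\,H^{-1}D)$, for any invertible matrix $H\in\mathbb{F}^{(n-k)\times(n-k)}$.
   Context: For a linear system $\Sigma=(A,B,C,D)$ with $A\in\mathbb{F}^{\delta\times\delta}$, $B\in\mathbb{F}^{\delta\times k}$, $C\in\mathbb{F}^{(n-k)\times\delta}$, $D\in\mathbb{F}^{(n-k)\times k}$ and $L\in\mathbb{N}$, let $T_L$ be the $(L+1)(n-k)\times(\delta+(L+1)k)$ matrix $$T_L=\begin{pmatrix} C&D&0&\cdots&0 \\ C A&CB&D&\cdots&0 \\ C A^2&CAB&CB&\ddots&\vdots \\ \vdots&\vdots&\vdots&\ddots&0 \\ C A^L&CA^{L-1}B&CA^{L-2}B&\cdots&D \end{pmatrix}.$$ That is, for $i=0,\dots,L$, block row $i$ of $T_L$ has first block $CA^i$, followed by blocks indexed by $j=0,\dots,L$ equal to $CA^{i-j-1}B$ if $j<i$, $D$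 if $j=i$, and $0$ if $j>i$. The system $\Sigma$ is output observable if and only if $T_L$ has maximal rank (i.e. rank equal to the minimum of its numbers of rows and columns) for all $L\in\mathbb{N}$; this rank condition is taken as the definition. *)

(* Defs.v *)
From mathcomp Require Import all_boot all_order all_algebra.

Set Implicit Arguments.
Unset Strict Implicit.
Unset Printing Implicit Defensive.

Import GRing.Theory.
Local Open Scope ring_scope.

Record linear_system (F : fieldType) (delta k n : nat) := LinearSystem {
  sysA : 'M[F]_delta;
  sysB : 'M[F]_(delta, k);
  sysC : 'M[F]_(n - k, delta);
  sysD : 'M[F]_(n - k, k)
}.

Section OutputObservability.

Variables (F : fieldType) (delta k n : nat).
Implicit Type S : linear_system F delta k n.

(* The truncated subtraction in the exponent is only reached when j < i. *)
Definition Tblock S (i j : nat) : 'M[F]_(n - k, k) :=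
  if (j < i)%N then sysC S *m sysA S ^+ (i - j - 1) *m sysB S
  else if j == i then sysD S
  else 0.

(* The row and column counts are those of \mxcol and \mxblock; they equal
   L.+1 * (n - k) and delta + L.+1 * k by sum_nat_const and card_ord. *)
Definition Tmx S (L : nat) :
    'M[F]_(\sum_(i < L.+1) (n - k), delta + \sum_(j < L.+1) k) :=
  row_mx (\mxcol_(i < L.+1) (sysC S *m sysA S ^+ i))
         (\mxblock_(i < L.+1, j < L.+1) Tblock S i j).

(* L = 0 is included: T_0 = (C D). *)
Definition output_observable S : Prop :=
  forall L : nat,
    \rank (Tmx S L) = minn (L.+1 * (n - k)) (delta + L.+1 * k).

Definition input_action S (Q : 'M[F]_k) : linear_system F delta k n :=
  LinearSystem (sysA S) (sysB S *m Q) (sysC S) (sysD S *m Q).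

Definition output_action S (H : 'M[F]_(n - k)) : linear_system F delta k n :=
  LinearSystem (sysA S) (sysB S) (invmx H *m sysC S) (invmx H *m sysD S).

End OutputObservability.

(* Main.v *)
(** Right multiplication of $B, D$ by $Q$ multiplies $T_L$ on the right by
    $\mathrm{diag}(I, Q, \dots, Q)$, and left multiplication of $C, D$ by $H^{-1}$
    multiplies $T_L$ on the left by $\mathrm{diag}(H^{-1}, \dots, H^{-1})$.
    These factors are invertible, so every rank of $T_L$ is unchanged. *)
Require Import Defs.
From mathcomp Require Import all_boot all_order all_algebra.

Local Open Scope ring_scope.

Import GRing.Theory.

(** The rank of a block diagonal matrix is the sum of the ranks of its blocks, and here each block
    contributes its full size. *)
Lemma unitmx_mxdiag (F : fieldType) (m : nat) (p : 'I_m -> nat)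
    (M : forall i, 'M[F]_(p i)) :
  (forall i, M i \in unitmx) -> mxdiag M \in unitmx.
Proof.
move=> Mu; rewrite -row_free_unit /row_free rank_mxdiag.
by apply/eqP/eq_bigr => i _; rewrite mxrank_unit.
Qed.

Lemma mxrank_mull_unit (F : fieldType) (m n : nat) (U : 'M[F]_m)
    (M : 'M[F]_(m, n)) :
  U \in unitmx -> \rank (U *m M) = \rank M.
Proof. by rewrite -row_full_unit => /eqmxMfull->. Qed.

Lemma mxrank_mulr_unit (F : fieldType) (m n : nat) (M : 'M[F]_(m, n))
    (U : 'M[F]_n) :
  U \in unitmx -> \rank (M *m U) = \rank M.
Proof. by rewrite -row_free_unit => /mxrankMfree->. Qed.

(** The rank demanded for each [L] depends only on [delta], [k] and [n], which both systems
    share. *)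
Lemma output_observable_eq_rank (F : fieldType) (delta k n : nat)
    (S S' : linear_system F delta k n) :
  (forall L, \rank (Tmx S' L) = \rank (Tmx S L)) ->
  output_observable S <-> output_observable S'.
Proof. by move=> eq_rk; split=> obs L; [rewrite eq_rk | rewrite -eq_rk]. Qed.

Section Actions.

Variables (F : fieldType) (delta k n : nat) (S : linear_system F delta k n).

Lemma Tblock_input_action (Q : 'M[F]_k) i j :
  Tblock (input_action S Q) i j = Tblock S i j *m Q.
Proof.
rewrite /Tblock /=; case: ifP => _; first by rewrite mulmxA.
by case: ifP => _; rewrite ?mul0mx.
Qed.

Lemma Tblock_output_action (H : 'M[F]_(n - k)) i j :
  Tblock (output_action S H) i j = invmx H *m Tblock S i j.
Proof.
rewrite /Tblock /=; case: ifP => _; first by rewrite !mulmxA.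
by case: ifP => _; rewrite ?mulmx0.
Qed.

(** The block [1%:M] has size [delta]: it fixes the first block column, which involves only [sysA]
    and [sysC]. *)
Lemma Tmx_input_action (Q : 'M[F]_k) L :
  Tmx (input_action S Q) L =
  Tmx S L *m block_mx 1%:M 0 0 (\mxdiag_(j < L.+1) Q).
Proof.
rewrite /Tmx mul_row_block !mulmx0 mulmx1 addr0 add0r mul_mxblock_mxdiag.
by congr row_mx; apply: eq_mxblock => i j; rewrite Tblock_input_action.
Qed.

(** Unlike the input action, this one also changes the first block column, since each of its blocks
    starts with [sysC]. *)
Lemma Tmx_output_action (H : 'M[F]_(n - k)) L :
  Tmx (output_action S H) L = (\mxdiag_(i < L.+1) invmx H) *m Tmx S L.
Proof.
rewrite /Tmx mul_mx_row mul_mxdiag_mxcol mul_mxdiag_mxblock.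
congr row_mx; first by apply: eq_mxcol => i; rewrite mulmxA.
by apply: eq_mxblock => i j; rewrite Tblock_output_action.
Qed.

End Actions.

Theorem proposition3p10 (F : finFieldType) (delta k n : nat)
    (delta_gt0 : (0 < delta)%N) (k_gt0 : (0 < k)%N) (k_lt_n : (k < n)%N)
    (S : linear_system F delta k n) :
  (forall Q : 'M[F]_k, Q \in unitmx ->
     output_observable S <-> output_observable (input_action S Q))
  /\
  (forall H : 'M[F]_(n - k), H \in unitmx ->
     output_observable S <-> output_observable (output_action S H)).
Proof.
split=> M Mu; apply: output_observable_eq_rank => L.
  (* The determinant of the right factor reduces to that of its diagonal of copies of [Q]. *)
  rewrite Tmx_input_action mxrank_mulr_unit // unitmxE det_ublock det1 mul1r.
  by rewrite -unitmxE; apply: unitmx_mxdiag.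
rewrite Tmx_output_action mxrank_mull_unit //.
by apply: unitmx_mxdiag => i; rewrite unitmx_inv.
Qed.
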